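(* For every real number $\epsilon$ with $0<\epsilon<\frac{1}{2}$, there exists an integer $\delta_0$ such that every tournament $T$ with $\delta^+(T)\geq \delta_0$ admits a bipartition $(A,B)$ of $V(T)$ such that $T[A]$ is strong, $d_A^+(v)\geq \left(\frac{1}{2}-\epsilon\right) d_T^+(v)$ for every $v\in A$, and $d_B^+(v)\geq \left(\frac{1}{2}-\epsilon\right) d_T^+(v)$ for every $v\in B$.
   Context: All digraphs are finite and simple (no loops, no multiple arcs). A tournament is an orientation of a complete graph. For a digraph $T$, $d_T^+(v)$ is the out-degree of $v$ in $T$ and $\delta^+(T)$ is the minimum out-degree of $T$. For a set $A$ of vertices, $d_A^+(v)$ denotes the number of out-neighbors of $v$ lying in $A$, and $T[A]$ is the subdigraph of $T$ induced by $A$. A bipartition $(A,B)$ of $V(T)$ is a partition of $V(T)$ into two disjoint nonempty sets $A$ and $B$. A digraph is strong if for every two vertices $x$ and $y$ there exists a directed path from $x$ to $y$. *)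

(* Defs.v *)
From HB Require Import structures.
From mathcomp Require Import all_boot all_order all_algebra.
From mathcomp Require Import reals.

Set Implicit Arguments.
Unset Strict Implicit.
Unset Printing Implicit Defensive.

(* A finite digraph without multiple arcs is a relation [e : rel V] on its
   finType of vertices, [e x y] meaning that there is an arc from x to y. *)

Definition tournament (V : finType) (e : rel V) : Prop :=
  irreflexive e /\ (forall x y : V, x != y -> e x y (+) e y x).

Definition outdeg_in (V : finType) (e : rel V) (A : {set V}) (v : V) : nat :=
  #|[set w in A | e v w]|.

Definition outdeg (V : finType) (e : rel V) (v : V) : nat :=
  #|[set w | e v w]|.

(* Since out-degrees are at most #|V|, the default value #|V| does not affect
   the minimum when V is nonempty; the digraph on no vertices gets 0. *)
Definition min_outdeg (V : finType) (e : rel V) : nat :=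
  \big[minn/#|V|]_(v : V) outdeg e v.

Definition induced (V : finType) (e : rel V) (A : {set V}) :
  rel {x : V | x \in A} := fun x y => e (val x) (val y).
Arguments induced {V} e A x y.

Definition strong (V : finType) (e : rel V) : Prop :=
  forall x y : V, connect e x y.

Definition bipartition (V : finType) (A B : {set V}) : Prop :=
  [/\ A != set0, B != set0, [disjoint A & B] & A :|: B = [set: V]].

(* Main.v *)
(* A uniformly random set A splits every out-neighbourhood almost evenly: by a
   Chernoff bound a vertex of out-degree d fails with probability exp(-c d).  The
   number of vertices is unbounded, but a tournament has at most 2k+1 vertices of
   out-degree k, so the union bound costs only the tail of a convergent series.
   Given such an A, replace it by a terminal strong component C of T[A].  Vertices
   of C keep all their out-neighbours in A, and the complement of C contains that
   of A, in which every vertex of T (including those of A \ C) has enough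
   out-neighbours. *)
Require Import Defs.
From HB Require Import structures.
From mathcomp Require Import all_boot all_order all_algebra.
From mathcomp Require Import reals sequences exp.
From mathcomp Require Import zify ring lra.

Import Order.TTheory GRing.Theory Num.Theory.
Local Open Scope ring_scope.

(** * Strong connectivity inside a vertex set *)

Section TerminalStrongComponent.
Variables (V : finType) (e : rel V).

(** A reachable set is always closed under arcs within [A]. Minimality of its size makes each of its
    vertices reach all of it, hence strength. *)
Lemma terminal_strong_subset (A : {set V}) : A != set0 ->
  exists C : {set V},
    [/\ C != set0, C \subset A,
        (forall v w, v \in C -> w \in A -> e v w -> w \in C)
      & strong (induced e C)].
Proof.
case/set0Pn => a aA.
pose eA := [rel x y | [&& x \in A, y \in A & e x y]].
(* A vertex with the fewest reachable vertices lies in a terminal component. *)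
pose reach x := [set y | connect eA x y].
case: (arg_minnP (fun x => #|reach x|) aA) => x xA xmin.
have xC : x \in reach x by rewrite inE connect0.
have sCA : reach x \subset A.
  apply/subsetP => y; rewrite inE => /connectP[p].
  elim/last_ind: p y => [|p z _] y /=; first by move=> _ ->.
  by rewrite rcons_path last_rcons => /andP[_ /and3P[_ zA _]] ->.
have closC v w : v \in reach x -> w \in A -> e v w -> w \in reach x.
  move=> vC wA evw; move: (vC); rewrite !inE => cxv.
  by apply: connect_trans cxv (connect1 _); rewrite /= (subsetP sCA _ vC) wA.
exists (reach x); split => //; first by apply/set0Pn; exists x.
move=> [y yC] [z zC].
have /connectP[p] : connect eA y z.
  have sub : reach y \subset reach x.
    by apply/subsetP => w; move: yC; rewrite !inE; apply: connect_trans.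
  have /eqP eqyx : reach y == reach x.
    by rewrite eqEcard sub (xmin y) //; exact: subsetP yC.
  by move: zC; rewrite -eqyx inE.
(* Lift the path from [A] to the subtype of [C]: closure keeps each successive vertex in [C]. *)
elim: p y yC => [|w p IHp] y yC /=.
  by move=> _ zy; subst z; rewrite (eq_irrelevance zC yC).
case/andP=> /and3P[_ wA eyw] pth lst.
have wC := closC _ _ yC wA eyw.
by apply: connect_trans (IHp w wC pth lst); apply: connect1.
Qed.

End TerminalStrongComponent.

(** * Out-degree counts and sums *)

Lemma leq_min_outdeg (V : finType) (e : rel V) (v : V) :
  (min_outdeg e <= outdeg e v)%N.
Proof.
have := mem_index_enum v; rewrite /min_outdeg.
elim: (index_enum V) => //= u s IHs; rewrite inE big_cons geq_min.
by case/orP => [/eqP <- | /IHs ->]; rewrite ?leqnn ?orbT.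
Qed.

(** Double counting of the arcs inside the class [S]: there are [#|S| * #|S|.-1 / 2] of them, and at
    most [k] leave each vertex. *)
Lemma tournament_card_outdeg (V : finType) (e : rel V) (k : nat) :
  tournament e -> (#|[set v | outdeg e v == k]| <= 2 * k + 1)%N.
Proof.
move=> [eirr etot]; set S := [set v | _].
have degE v : v \in S -> (\sum_(w in S) e v w <= k)%N.
  rewrite inE => /eqP <-; rewrite /outdeg -sum1_card.
  rewrite [X in (_ <= X)%N](eq_bigl (fun w => e v w)) => [|w];
    last by rewrite inE.
  rewrite [X in (_ <= X)%N]big_mkcond /= [X in (X <= _)%N]big_mkcond /=.
  by apply: leq_sum => w _; case: (w \in S); case: (e v w).
have pairE v w : (e v w + e w v = (v != w))%N.
  case: (eqVneq v w) => [-> | /etot]; first by rewrite !eirr.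
  by case: (e v w); case: (e w v).
have sum2 : (\sum_(v in S) \sum_(w in S) (e v w + e w v) = #|S| * #|S|.-1)%N.
  rewrite -sum_nat_const; apply: eq_bigr => v vS.
  rewrite (eq_bigr (fun w => (v != w) : nat)) => [|w _]; last by rewrite pairE.
  rewrite (bigD1 v) //= eqxx add0n (cardD1 v) vS /= -sum1_card.
  rewrite [RHS](eq_bigl (fun w => (w \in S) && (w != v))).
    by apply: eq_bigr => w /andP[_]; rewrite eq_sym => ->.
  by move=> w; rewrite !inE andbC.
have : (#|S| * #|S|.-1 <= #|S| * (2 * k))%N.
  rewrite -sum2; under eq_bigr do rewrite big_split /=.
  rewrite big_split /= [X in (_ + X <= _)%N]exchange_big /= addnn -mul2n mulnCA.
  by rewrite leq_pmul2l // -sum_nat_const leq_sum.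
by case: #|S| => // n; rewrite leq_pmul2l //= addn1 ltnS.
Qed.

Section OutdegreeSum.
Variable R : realType.

(* Clamping at m+1 makes the right-hand side telescope from k = 0. *)
Lemma inv_cube_telescope (m k : nat) : (m.+2 <= k)%N ->
  (2 * k + 1)%:R * (k%:R ^+ 3)^-1 <=
  3 * ((maxn k.-1 m.+1)%:R^-1 - (maxn k m.+1)%:R^-1) :> R.
Proof.
case: k => // k; rewrite ltnS => mk /=.
rewrite (maxn_idPl mk) (maxn_idPl (leqW mk)).
have x1 : (1 : R) <= k%:R by rewrite ler1n (leq_trans _ mk).
rewrite natrD natrM -(natr1 k); move: x1; move: (k%:R : R) => x x1.
rewrite ler_pdivrMr; last by apply: exprn_gt0; lra.
have -> : 3 * (x^-1 - (x + 1)^-1) * (x + 1) ^+ 3 = 3 * (x + 1) ^+ 2 / x.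
  by field; apply/andP; split; lra.
rewrite ler_pdivlMr; nra.
Qed.

(** Grouping vertices by out-degree [k] bounds the sum by the tail of the series of [(2k+1)/k^3],
    whatever the size of [V]. *)
Lemma sum_inv_outdeg_cube (V : finType) (e : rel V) (m : nat) :
  tournament e -> (forall v, (m.+2 <= outdeg e v)%N) ->
  \sum_v ((outdeg e v)%:R ^+ 3)^-1 <= 3 * m.+1%:R^-1 :> R.
Proof.
move=> et dm.
pose g k : R := (maxn k m.+1)%:R^-1.
have dn v : (outdeg e v < #|V|.+1)%N by rewrite ltnS /outdeg max_card.
pose d v : 'I_(#|V|.+1) := Ordinal (dn v).
rewrite (partition_big d xpredT) //=.
(* The term [k = 0] vanishes, since [0.-1] is [0]. *)
have tele n : \sum_(k < n.+1) (g k.-1 - g k) = g 0%N - g n.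
  elim: n => [|n IHn]; first by rewrite big_ord_recl big_ord0 /= addr0.
  by rewrite big_ord_recr /= IHn; ring.
have g_ge0 k : 0 <= g k by rewrite invr_ge0 ler0n.
apply: (@le_trans _ _ (\sum_(k < #|V|.+1) 3 * (g k.-1 - g k))); last first.
  by rewrite -mulr_sumr tele ler_wpM2l // /g max0n lerBlDr lerDl; exact: g_ge0.
apply: ler_sum => k _.
rewrite (eq_bigr (fun=> ((k : nat)%:R ^+ 3)^-1)); last by move=> v /eqP <-.
rewrite /g; case: (leqP m.+2 k) => km.
  apply: le_trans (inv_cube_telescope _ _ km).
  rewrite sumr_const -[X in X <= _]mulr_natl ler_wpM2r ?invr_ge0 ?exprn_ge0 //.
  rewrite ler_nat; apply: leq_trans (tournament_card_outdeg _ _ k et).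
  by apply/eq_leq/eq_card => v; rewrite inE.
(* Here [k <= m.+1]: the class is empty and the clamped difference is zero. *)
rewrite big1 => [|v /eqP dv]; last first.
  by move: km; rewrite -dv ltnNge dm.
have -> : maxn k.-1 m.+1 = maxn k m.+1 by lia.
by rewrite subrr mulr0.
Qed.

End OutdegreeSum.

(** * Exponential moments of a random vertex set *)

Section RandomSubset.
Variable R : realType.

(** Independence of the vertices, as the expansion of a product over [V] into a sum over subsets;
    each vertex outside [N] gives a factor 2. *)
Lemma sum_expR_signed (V : finType) (N : {set V}) (s : R) :
  \sum_(A : {set V}) expR (\sum_(u in N) (if u \in A then s else - s)) =
  2 ^+ #|V| * ((expR s + expR (- s)) / 2) ^+ #|N|.
Proof.
transitivity (\prod_(u : V) (expR (if u \in N then s else 0) +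
                             expR (if u \in N then - s else 0))).
  rewrite bigA_distr; apply: eq_bigr => A _.
  rewrite big_mkcond expR_sum /=; apply: eq_bigr => u _.
  by case: (u \in N); case: (u \in A).
rewrite -(prodr_const (mem N)) -(prodr_const predT) [X in _ = _ * X]big_mkcond /=.
rewrite -big_split /=; apply: eq_bigr => u _.
by case: (u \in N); rewrite ?expR0; field.
Qed.

(** The sharp exponent is [s^2 / 2]; the cruder 3/2 follows from [1 + x <= expR x] alone and stays
    below the 2 in the Markov weight used later. *)
Lemma cosh_le_expR (s : R) : 0 < s -> s < 1 / 2 ->
  (expR s + expR (- s)) / 2 <= expR (3 / 2 * s ^+ 2).
Proof.
move=> s0 s1.
have ub (x y : R) : 0 <= y -> 1 <= y * (1 - x) -> expR x <= y.
  move=> y0 xy; rewrite -[x]opprK expRN -div1r ler_pdivrMr ?expR_gt0 //.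
  by apply: le_trans xy _; rewrite ler_wpM2l // expR_ge1Dx.
have h1 : expR s <= 1 + s + 2 * s ^+ 2 by apply: ub; nra.
have h2 : expR (- s) <= 1 - s + s ^+ 2 by apply: ub; nra.
apply: le_trans (expR_ge1Dx _); lra.
Qed.

(** One term of the exponential series. The cube is the first integer power that stays summable
    against [2k+1]. *)
Lemma expR_neg_le_cube (x : R) : 0 < x -> expR (- x) <= 6 * (x ^+ 3)^-1.
Proof.
move=> x0; have x3 : 0 < x ^+ 3 by apply: exprn_gt0.
rewrite expRN -div1r ler_pdivrMr ?expR_gt0 // -mulrA.
have := expR_ge1Dxn 2 (ltW x0); rewrite (_ : 3`!%N = 6%N) // => h.
have h' : x ^+ 3 <= 6 * expR x.
  by rewrite mulrC -ler_pdivrMr //; apply: le_trans h; rewrite lerDr.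
by rewrite mulrCA mulrC ler_pdivlMr // mul1r.
Qed.

Lemma outdeg_in_setC (V : finType) (e : rel V) (A : {set V}) (v : V) :
  ((outdeg_in e A v) + (outdeg_in e (~: A) v) = outdeg e v)%N.
Proof.
rewrite /outdeg -(cardsID A).
by congr addn; apply: eq_card => w; rewrite !inE andbC.
Qed.

Lemma signed_sum_outdeg (V : finType) (e : rel V) (A : {set V}) (v : V) (s : R) :
  \sum_(u in [set w | e v w]) (if u \in A then s else - s) =
  s * (2 * (outdeg_in e A v)%:R - (outdeg e v)%:R).
Proof.
rewrite -(outdeg_in_setC V e A v) natrD.
rewrite (bigID (mem A)) /=.
rewrite (eq_bigr (fun=> s)); last by move=> u /andP[_ ->].
rewrite [X in _ + X](eq_bigr (fun=> - s)); last by move=> u /andP[_ /negPf ->].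
rewrite !big_const !iter_addr_0.
rewrite (_ : #|_| = outdeg_in e A v); last first.
  by apply: eq_card => u; rewrite -topredE /= !inE andbC.
rewrite (_ : #|_| = outdeg_in e (~: A) v); last first.
  by apply: eq_card => u; rewrite -topredE /= !inE andbC.
rewrite -(mulr_natr s) -(mulr_natr (- s)); ring.
Qed.

Lemma balanced_subset (eps : R) : 0 < eps -> eps < 1 / 2 ->
  exists delta0 : nat, forall (V : finType) (e : rel V),
    tournament e -> (forall v, (delta0 <= outdeg e v)%N) ->
    exists A : {set V}, forall v,
      (1 / 2 - eps) * (outdeg e v)%:R <= (outdeg_in e A v)%:R /\
      (1 / 2 - eps) * (outdeg e v)%:R <= (outdeg_in e (~: A) v)%:R.
Proof.
move=> e0 e1.
(* The decay rate: [2 * eps^2] from the Markov threshold minus [3/2 * eps^2] from the moment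
   bound. *)
pose c := eps ^+ 2 / 2.
have c0 : 0 < c by rewrite /c; nra.
have c3 : 0 < c ^+ 3 by apply: exprn_gt0.
(* 36 is 2 (signs) times 6 (cube bound) times 3 (degree sum). *)
pose m := Num.bound (36 / c ^+ 3).
exists m.+2 => V e et dm.
pose d v := outdeg e v.
pose N v := [set w | e v w].
pose S s (A : {set V}) v : R := \sum_(u in N v) (if u \in A then s else - s).
(* Markov's inequality in disguise: W A v >= 1 as soon as A is unbalanced at v. *)
pose W (A : {set V}) v :=
  expR (- (2 * eps ^+ 2 * (d v)%:R)) *
  (expR (S eps A v) + expR (S (- eps) A v)).
have W_ge0 A v : 0 <= W A v by rewrite mulr_ge0 ?addr_ge0 ?expR_ge0.
have [[A ltW1] | no] :
    (exists A, \sum_v W A v < 1) \/ (forall A, 1 <= \sum_v W A v).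
  case: (pickP [pred A | \sum_v W A v < 1]) => [A | no].
    by left; exists A.
  by right=> A; rewrite leNgt; have /= -> := no A.
- exists A => v.
  have lt1 : W A v < 1.
    apply: le_lt_trans ltW1; rewrite (bigD1 v) //= lerDl.
    by apply: sumr_ge0 => u _; apply: W_ge0.
  have bd s : expR (- (2 * eps ^+ 2 * (d v)%:R)) * expR (S s A v) <= W A v ->
      S s A v < 2 * eps ^+ 2 * (d v)%:R.
    move=> /le_lt_trans/(_ lt1).
    by rewrite -expRD -[X in _ < X -> _]expR0 ltr_expR addrC subr_lt0.
  have /bd : expR (- (2 * eps ^+ 2 * (d v)%:R)) * expR (S eps A v) <= W A v.
    by rewrite /W mulrDr lerDl mulr_ge0 ?expR_ge0.
  have /bd : expR (- (2 * eps ^+ 2 * (d v)%:R)) * expR (S (- eps) A v) <= W A v.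
    by rewrite /W mulrDr lerDr mulr_ge0 ?expR_ge0.
  rewrite /S !signed_sum_outdeg /d -(outdeg_in_setC V e A v) natrD.
  set x := (outdeg_in e A v)%:R; set y := (outdeg_in e (~: A) v)%:R => h1 h2.
  (* Cancelling [eps] bounds [|x - y|] by [2 * eps * (x + y)], so both [x] and [y] exceed
     [(1/2 - eps) * (x + y)]. *)
  have k1 : eps * (x - y) < eps * (2 * eps * (x + y)) by lra.
  have k2 : eps * (y - x) < eps * (2 * eps * (x + y)) by lra.
  rewrite !ltr_pM2l // in k1 k2; split; lra.
have sumW v : \sum_(A : {set V}) W A v <=
    2 ^+ #|V| * (12 / c ^+ 3 * ((d v)%:R ^+ 3)^-1).
  have dE : #|N v| = d v by [].
  have d0 : 0 < (d v)%:R :> R by rewrite ltr0n (leq_trans _ (dm v)).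
  rewrite -mulr_sumr big_split /= !sum_expR_signed opprK dE [expR (- eps) + _]addrC.
  set C := (_ + _) / 2.
  have C_ge0 : 0 <= C by rewrite divr_ge0 // addr_ge0 ?expR_ge0.
  have leC : C ^+ d v <= expR (3 / 2 * eps ^+ 2 * (d v)%:R).
    by rewrite mulrC expRM_natl lerXn2r ?nnegrE ?expR_ge0 // cosh_le_expR.
  rewrite -mulrDr mulrCA ler_pM2l ?exprn_gt0 //.
  apply: (@le_trans _ _ (2 * expR (- (c * (d v)%:R)))).
    have -> : - (c * (d v)%:R) =
        - (2 * eps ^+ 2 * (d v)%:R) + 3 / 2 * eps ^+ 2 * (d v)%:R :> R.
      by rewrite /c; field.
    rewrite expRD [leRHS]mulrCA ler_wpM2l ?expR_ge0 //; lra.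
  have := expR_neg_le_cube (c * (d v)%:R) (mulr_gt0 c0 d0).
  rewrite exprMn invfM; lra.
(* With no good [A], the average total weight is at least 1, but [sumW] and the choice of [m] make
   it smaller. *)
have : \sum_(A : {set V}) (1 : R) <= \sum_(A : {set V}) \sum_v W A v.
  exact: ler_sum.
rewrite exchange_big /= => /le_trans/(_ (ler_sum _ (fun v _ => sumW v))).
rewrite sumr_const -mulr_sumr -mulr_sumr.
have -> : #|{set V}| = (2 ^ #|V|)%N.
  rewrite -[#|V|]cardsT -card_powerset.
  by apply: eq_card => X; rewrite !inE subsetT.
rewrite natrX -[X in X <= _]mulr1 ler_pM2l ?exprn_gt0 // leNgt => /negP[].
apply: (@le_lt_trans _ _ (12 / c ^+ 3 * (3 * m.+1%:R^-1))).
  by apply: ler_wpM2l; [rewrite divr_ge0 // ltW | exact: sum_inv_outdeg_cube].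
have lt_m : 36 / c ^+ 3 < m.+1%:R.
  by apply: lt_le_trans (archi_boundP _) _; rewrite ?divr_ge0 ?(ltW c3) // ler_nat.
rewrite mulrA ltr_pdivrMr ?ltr0n // mul1r; lra.
Qed.

End RandomSubset.

(** * The strong bipartition *)

Theorem corollary1 (R : realType) (eps : R) (eps_gt0 : 0 < eps)
    (eps_lt_half : eps < 1 / 2) :
  exists delta0 : nat,
    forall (V : finType) (e : rel V),
      tournament e ->
      (delta0 <= min_outdeg e)%N ->
      exists A B : {set V},
        [/\ bipartition A B,
            strong (induced e A),
            (forall v : V, v \in A ->
               (1 / 2 - eps) * (outdeg e v)%:R <= (outdeg_in e A v)%:R)
          & (forall v : V, v \in B ->
               (1 / 2 - eps) * (outdeg e v)%:R <= (outdeg_in e B v)%:R)].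
Proof.
have [delta0 bal] := balanced_subset R eps eps_gt0 eps_lt_half.
(* The successor makes every out-degree positive, which forces both sides of the balanced split to
   be nonempty. *)
exists delta0.+1 => V e et min_e.
have dv v : (delta0.+1 <= outdeg e v)%N := leq_trans min_e (leq_min_outdeg V e v).
have [A balA] := bal V e et (fun v => ltnW (dv v)).
(* On an empty [V] the default value gives minimum out-degree 0, below [delta0.+1]. *)
have [v0 _] : exists v0 : V, true.
  case: (pickP (@predT V)) => [v0 _ | noV]; first by exists v0.
  by move: min_e; rewrite /min_outdeg big_pred0 // (eq_card0 noV).
have nonempty (X : {set V}) :
    (1 / 2 - eps) * (outdeg e v0)%:R <= (outdeg_in e X v0)%:R -> X != set0.
  apply: contraTneq => ->.
  rewrite (_ : outdeg_in e set0 v0 = 0%N); last first.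
    by apply: eq_card0 => w; rewrite !inE.
  rewrite -ltNge mulr_gt0 ?ltr0n ?(leq_trans _ (dv v0)) //; lra.
have [A0 B0] : A != set0 /\ ~: A != set0.
  by case: (balA v0) => h1 h2; split; apply: nonempty.
have [C [C0 sCA closC strC]] := terminal_strong_subset V e A A0.
exists C, (~: C); split => //.
- split; rewrite ?setUCr -?setI_eq0 ?setICr //.
  by apply: contraNneq B0 => CC; rewrite -subset0 -CC setCS.
- move=> v vC; apply: le_trans (balA v).1 _; rewrite ler_nat.
  apply/subset_leq_card/subsetP => w; rewrite !inE => /andP[wA evw].
  by rewrite evw (closC v w).
- move=> v _; apply: le_trans (balA v).2 _; rewrite ler_nat.
  apply/subset_leq_card/subsetP => w; rewrite !inE => /andP[wA ->].
  by rewrite andbT; apply: contraNN wA; apply: subsetP.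
Qed.
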